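(* For all positive $\rho_s,\rho_f,\alpha,H_s$, for all finite sequences of positive numbers $\{\mu_i\}_{i=1}^N$, $\{\lambda_i\}_{i=1}^N$, and for all real $\beta,\psi$ with $\beta+\psi\lambda_i>0$ for every $i=1,\dots,N$, there exists $\delta>0$ such that, if $0<\Delta t<\delta$, then for all $i=1,\dots,N$ the polynomial $$\chi(y)=\frac{\rho_sH_s}{\Delta t^2}\Big(1+\frac{\alpha\Delta t}{\rho_f\mu_i}\Big)y^4+\Big(-\frac{2\alpha\rho_sH_s}{\rho_f\mu_i\Delta t}+\frac{\alpha\Delta t}{\rho_f\mu_i}(\beta+\psi\lambda_i)+\frac{\alpha}{\Delta t}-\frac{4\rho_sH_s}{\Delta t^2}\Big)y^3+\Big(\frac{\alpha\rho_sH_s}{\rho_f\mu_i\Delta t}-\frac{2\alpha}{\Delta t}+\frac{6\rho_sH_s}{\Delta t^2}\Big)y^2+\Big(\frac{\alpha}{\Delta t}-\frac{4\rho_sH_s}{\Delta t^2}\Big)y+\frac{\rho_sH_s}{\Delta t^2}$$ has four simple roots in the open unit disc of the complex plane.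
   Context: The polynomial $\chi$ is the characteristic polynomial of the $i$-th modal difference equation of the explicit Robin-Neumann scheme for a model fluid-structure interaction problem: $\rho_f,\rho_s$ are the fluid and structure densities, $H_s$ the structure thickness, $\beta,\psi$ the elasticity parameters of the structure, $\alpha$ the Robin interface parameter, $\Delta t$ the time step, and $\mu_i,\lambda_i$ the eigenvalues of the (discrete) added mass operator and of the (discrete) Laplace operator on the interface. No other information is needed for the statement. *)

(* Defs.v *)
From mathcomp Require Import all_boot all_order all_algebra.
From mathcomp Require Import all_reals.
From mathcomp Require Export complex.

Set Implicit Arguments.
Unset Strict Implicit.
Unset Printing Implicit Defensive.

Import GRing.Theory Num.Theory.
Local Open Scope ring_scope.

(* Here [dt] is the time step, and [mu], [lambda] are the eigenvalues of the
   added mass and interface Laplace operators for one fixed mode. *)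
Definition chi (R : realType) (rho_s rho_f alpha H_s beta psi dt mu lambda : R)
    : {poly R} :=
    (rho_s * H_s / dt ^+ 2 * (1 + alpha * dt / (rho_f * mu))) *: 'X^4
  + (- (2 * alpha * rho_s * H_s / (rho_f * mu * dt))
     + alpha * dt / (rho_f * mu) * (beta + psi * lambda)
     + alpha / dt
     - 4 * rho_s * H_s / dt ^+ 2) *: 'X^3
  + (alpha * rho_s * H_s / (rho_f * mu * dt)
     - 2 * alpha / dt
     + 6 * rho_s * H_s / dt ^+ 2) *: 'X^2
  + (alpha / dt - 4 * rho_s * H_s / dt ^+ 2) *: 'X
  + (rho_s * H_s / dt ^+ 2)%:P.

Definition chiC (R : realType) (rho_s rho_f alpha H_s beta psi dt mu lambda : R)
    : {poly R[i]} :=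
  map_poly (real_complex R)
    (chi rho_s rho_f alpha H_s beta psi dt mu lambda).

(* The norm is R[i]-valued: [`|z| < 1] is the order of R[i] on real elements. *)
Definition four_simple_roots_in_unit_disc (R : realType) (p : {poly R[i]}) : Prop :=
  exists s : seq R[i],
    [/\ uniq s, size s = 4%N &
        forall z, z \in s -> mup z p = 1%N /\ `|z| < 1].

(* Main.v *)
Require Import Defs.
From mathcomp Require Import all_boot all_order all_algebra.
From mathcomp Require Import all_reals.
From mathcomp Require Import polyrcf ring lra.
Set Implicit Arguments.
Unset Strict Implicit.
Unset Printing Implicit Defensive.
Import Order.TTheory GRing.Theory Num.Theory.
Local Open Scope ring_scope.

(** For a fixed mode put [t = dt], [a = alpha / (rho_f * mu)],
    [c = alpha / (rho_s * H_s)] and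
    [e = a * (beta + psi * lambda) / (rho_s * H_s)]. Divided by
    [rho_s * H_s / t ^+ 2], the polynomial [chi] is
      [(y - 1)^4 + a t y^2 (y - 1)^2 + c t y (y - 1)^2 + e t^3 y^3],
    so that its four roots all tend to the boundary point [1] as [t] tends to
    [0], and the limit polynomial decides nothing. The Cayley substitution
    [y = (1 + z) / (1 - z)], which maps the open left half-plane onto the open
    unit disc, turns it, up to the factor [(1 - z)^4], into the quartic
      [A4 z^4 + A3 z^3 + A2 z^2 + A1 z + A0]
    with
      [A4 = 16 + 4 (a - c) t - e t^3], [A3 = 8 a t - 2 e t^3],
      [A2 = 4 (a + c) t], [A1 = 2 e t^3], [A0 = e t^3],
    of respective orders [1], [t], [t], [t^3], [t^3] in [t]. Stability and
    simplicity can now be read off these leading terms.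

    Stability: by the Routh-Hurwitz criterion the roots [z] lie in the open
    left half-plane when the [Ai] are positive and
    [A4 A1^2 + A3^2 A0 < A3 A2 A1]. Here the two sides are, to leading order,
    [64 a^2 e t^5] and [64 a (a + c) e t^5], so the inequality holds because
    [c] is positive. The criterion is proved in [hurwitz4_root_Re_lt0] by
    dividing the even part of the quartic by its odd part.

    Simplicity: for small [t] the quartic has no real root
    ([no_real_root_quartic]). A multiple root would then come with its distinct
    conjugate, and the quartic would be a constant times the square of
    a quadratic, which forces [A4 A1^2 = A3^2 A0] ([two_double_roots]). But the
    left-hand side is of order [t^6] and the right-hand side of order [t^5].

    All these conditions are strict polynomial inequalities in [t] that hold
    for small positive [t] ([stable_simple_small]); one [delta] serves all the
    modes because there are finitely many of them. *)

(** * Quartics with roots in the open left half-plane *)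

(** The third condition is the Routh-Hurwitz inequality, the next two exclude
    real roots, and the last one excludes a pair of conjugate double roots.
    They are meant both for real coefficients and for their images in the
    complex numbers, where [0 < x] entails that [x] is real. *)
Definition stable_simple (F : numDomainType) (A0 A1 A2 A3 A4 : F) : Prop :=
  [/\ [/\ 0 < A0, 0 < A1 & 0 < A2], 0 < A3 /\ 0 < A4,
      A4 * A1 ^+ 2 + A3 ^+ 2 * A0 < A3 * A2 * A1,
      A3 ^+ 2 < 2 * A4 * A2 /\ A1 ^+ 2 < 2 * A2 * A0 &
      A4 * A1 ^+ 2 < A3 ^+ 2 * A0].

Definition quartic (F : nzRingType) (a0 a1 a2 a3 a4 : F) : {poly F} :=
  Poly [:: a0; a1; a2; a3; a4].

Lemma horner_quartic (F : comNzRingType) (a0 a1 a2 a3 a4 x : F) :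
  (quartic a0 a1 a2 a3 a4).[x] =
  a4 * x ^+ 4 + a3 * x ^+ 3 + a2 * x ^+ 2 + a1 * x + a0.
Proof. by rewrite horner_Poly /=; ring. Qed.

Lemma size_quartic (F : nzRingType) (a0 a1 a2 a3 a4 : F) : a4 != 0 ->
  size (quartic a0 a1 a2 a3 a4) = 5%N.
Proof. by move=> a4n; rewrite /quartic (@PolyK _ 0). Qed.

(** One step of the Euclidean algorithm underlying Routh-Hurwitz:
    the sign of the real part of [u] times the conjugate of [v] tells
    whether [u / v] is in the closed right half-plane, and keeps a meaning when
    [v = 0]. With this reading the property passes from [u / v] to
    [k * z + v / u]. *)
Lemma Re_step (C : numClosedFieldType) (k z u v : C) : 0 < k -> 0 <= 'Re z ->
  0 <= 'Re (u * v^*) -> 0 <= 'Re ((k * z * u + v) * u^*).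
Proof.
move=> k0 z0 uv0.
have -> : (k * z * u + v) * u^* = k * `|u| ^+ 2 * z + (u * v^*)^*.
  by rewrite normCK rmorphM /= conjCK; ring.
have ku0 : 0 <= k * `|u| ^+ 2 by rewrite mulr_ge0 ?exprn_ge0 ?(ltW k0).
rewrite raddfD /= Re_conj; apply: addr_ge0 => //.
by rewrite ReMl ?ger0_real // mulr_ge0.
Qed.

(** Suppose that [z] is a root with [0 <= 'Re z]. Let [O] be the odd part of
    the quartic at [z]; its even part is then [- O]. The Euclidean algorithm
    applied to the even and odd parts has linear quotients, whose slopes
    [A4 / A3], [A3 / B], [B / D] are positive by the Routh-Hurwitz inequality.
    Hence [Re_step] gives [0 <= - `|O| ^+ 2], that is [O = 0]. All the
    remainders then vanish, including the last one, [A0]. *)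
Lemma hurwitz4_root_Re_lt0 (C : numClosedFieldType) (A0 A1 A2 A3 A4 z : C) :
  0 < A0 -> 0 < A1 -> 0 < A3 -> 0 < A4 ->
  A4 * A1 ^+ 2 + A3 ^+ 2 * A0 < A3 * A2 * A1 ->
  A4 * z ^+ 4 + A3 * z ^+ 3 + A2 * z ^+ 2 + A1 * z + A0 = 0 -> 'Re z < 0.
Proof.
move=> A0p A1p A3p A4p hurw Qz0.
rewrite real_ltNge ?Creal_Re ?real0 //; apply/negP => z0.
have A3n := lt0r_neq0 A3p; have A1n := lt0r_neq0 A1p.
pose B := A2 - A4 * A1 / A3.
have Bp : 0 < B.
  have -> : B = (A3 * A2 * A1 - A4 * A1 ^+ 2) / (A3 * A1).
    by rewrite /B; field; rewrite A3n A1n.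
  apply: divr_gt0; last exact: mulr_gt0.
  rewrite subr_gt0; apply: le_lt_trans hurw.
  by rewrite lerDl mulr_ge0 ?exprn_ge0 // ltW.
have Bn := lt0r_neq0 Bp.
pose D := A1 - A3 * A0 / B.
have Dp : 0 < D.
  have -> : D = (A3 * A2 * A1 - (A4 * A1 ^+ 2 + A3 ^+ 2 * A0)) / (A3 * B).
    rewrite /D -[X in X - _](mulfK Bn) -(mulfK A3n (A1 * B)).
    by rewrite {1}/B; field; rewrite A3n Bn.
  by rewrite divr_gt0 ?subr_gt0 // mulr_gt0.
have Dn := lt0r_neq0 Dp.
pose O := A3 * z ^+ 3 + A1 * z.
pose E1 := B * z ^+ 2 + A0.
pose O1 := D * z.
have EE : - O = A4 / A3 * z * O + E1.
  transitivity (A4 * z ^+ 4 + A2 * z ^+ 2 + A0).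
    apply/eqP; rewrite eq_sym -addr_eq0 /O -[X in _ == X]Qz0; apply/eqP; ring.
  by rewrite /E1 /O /B; field.
have OE : O = A3 / B * z * E1 + O1 by rewrite /E1 /O /O1 /D; field.
have E1E : E1 = B / D * z * O1 + A0 by rewrite /E1 /O1; field.
(* Climb back from the last remainder to the even part. *)
have h1 : 0 <= 'Re (O1 * A0^*).
  by rewrite conj_Creal ?gtr0_real // /O1 ReMr ?gtr0_real // ReMl ?gtr0_real //
     !mulr_ge0 // ltW.
have h2 : 0 <= 'Re (E1 * O1^*) by rewrite E1E Re_step ?divr_gt0.
have h3 : 0 <= 'Re (O * E1^*) by rewrite {1}OE Re_step ?divr_gt0.
have : 0 <= 'Re (- O * O^*) by rewrite EE Re_step ?divr_gt0.
rewrite mulNr -normCK raddfN /= (Creal_ReP _ _) ?rpredX ?normr_real //.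
rewrite oppr_ge0 => O_le0.
have O0 : O = 0.
  by apply/eqP; rewrite -normr_eq0 -sqrf_eq0 eq_le O_le0 exprn_ge0.
have E10 : E1 = 0 by move: EE; rewrite O0 mulr0 add0r oppr0.
have /eqP : O1 = 0 by move: OE; rewrite O0 E10 mulr0 add0r.
move/eqP=> O10; move: E1E; rewrite E10 O10 mulr0 add0r => /esym/eqP.
by rewrite gt_eqF.
Qed.

(** Split the term [A2 z^2] evenly between [A4 z^4 + A3 z^3] and [A1 z + A0]:
    each half is, up to a factor [z^2], a quadratic of negative discriminant. *)
Lemma no_real_root_quartic (C : numClosedFieldType) (A0 A1 A2 A3 A4 z : C) :
  0 < A0 -> 0 < A2 -> 0 < A4 ->
  A3 \is Num.real -> A1 \is Num.real ->
  A3 ^+ 2 < 2 * A4 * A2 -> A1 ^+ 2 < 2 * A2 * A0 ->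
  A4 * z ^+ 4 + A3 * z ^+ 3 + A2 * z ^+ 2 + A1 * z + A0 = 0 ->
  z \isn't Num.real.
Proof.
move=> A0p A2p A4p A3r A1r d3 d1 Qz0; apply/negP => zr.
have: 0 < 4 * A4 * A2 *
    (A4 * z ^+ 4 + A3 * z ^+ 3 + A2 * z ^+ 2 + A1 * z + A0).
  have -> : 4 * A4 * A2 *
      (A4 * z ^+ 4 + A3 * z ^+ 3 + A2 * z ^+ 2 + A1 * z + A0) =
      A2 * z ^+ 2 * ((2 * A4 * z + A3) ^+ 2 + (2 * A4 * A2 - A3 ^+ 2))
        + 2 * A4 * ((A2 * z + A1) ^+ 2 + (2 * A2 * A0 - A1 ^+ 2)) by ring.
  have sq_ge0 x : x \is Num.real -> 0 <= x ^+ 2.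
    by move=> xr; rewrite real_exprn_even_ge0.
  have A4r := gtr0_real A4p; have A2r := gtr0_real A2p.
  have p2 : 0 < 2 * A4 by rewrite mulr_gt0.
  apply: ltr_wpDl; last first.
    rewrite mulr_gt0 // ltr_wpDl ?subr_gt0 //.
    by rewrite sq_ge0 // rpredD // rpredM.
  apply: mulr_ge0; first by rewrite mulr_ge0 ?(ltW A2p) // sq_ge0.
  apply: addr_ge0; last by rewrite subr_ge0 ltW.
  by rewrite sq_ge0 // rpredD // rpredM // gtr0_real.
by rewrite Qz0 mulr0 ltxx.
Qed.

Lemma mul_sqr_XsubC (F : comNzRingType) (x y : F) :
  ('X - x%:P) ^+ 2 * ('X - y%:P) ^+ 2 =
  quartic ((x * y) ^+ 2) (- (2 * (x + y) * (x * y)))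
    ((x + y) ^+ 2 + 2 * (x * y)) (- (2 * (x + y))) 1.
Proof. by rewrite /quartic /= !cons_poly_def; ring. Qed.

(** A quartic with two double roots is a multiple of [(X^2 + p X + q)^2], and
    the relation says that the coefficients [1], [2p], [2pq], [q^2] of degrees
    4, 3, 1, 0 of this square satisfy [(2pq)^2 = (2p)^2 q^2]. *)
Lemma two_double_roots (F : fieldType) (A0 A1 A2 A3 A4 x y : F) :
  A4 != 0 -> x != y ->
  (1 < mup x (quartic A0 A1 A2 A3 A4))%N ->
  (1 < mup y (quartic A0 A1 A2 A3 A4))%N ->
  A4 * A1 ^+ 2 = A3 ^+ 2 * A0.
Proof.
move=> A4n xy; set Q := quartic _ _ _ _ _.
have sQ : size Q = 5%N by exact: size_quartic.
have Qn : Q != 0 by rewrite -size_poly_gt0 sQ.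
move=> x2 y2.
have dx : ('X - x%:P) ^+ 2 %| Q by rewrite -(mup_geq x 2 Qn).
have dy : ('X - y%:P) ^+ 2 %| Q by rewrite -(mup_geq y 2 Qn).
have: ('X - x%:P) ^+ 2 * ('X - y%:P) ^+ 2 %| Q.
  rewrite Gauss_dvdp ?dx ?dy // coprimep_pexpl // coprimep_pexpr //.
  by rewrite coprimep_XsubC2 // subr_eq0 eq_sym.
rewrite mul_sqr_XsubC => dQ.
move: (dvdp_size_eqp dQ); rewrite sQ size_quartic ?oner_eq0 // eqxx.
move=> /esym/eqpP[[c d] /= /andP[_ dn] cE].
have co i := congr1 (fun p : {poly F} => p`_i) cE.
have := co 0%N; have := co 1%N; have := co 3%N; have := co 4%N.
rewrite !coefZ !coef_Poly /= => h4 h3 h1 h0.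
(* The relation is homogeneous of degree 3 in the coefficients. *)
apply: (mulfI dn); apply: (mulfI dn); apply: (mulfI dn).
transitivity ((d * A4) * (d * A1) ^+ 2); first by ring.
transitivity ((d * A3) ^+ 2 * (d * A0)); last by ring.
by rewrite -h4 -h3 -h1 -h0; ring.
Qed.

Lemma hurwitz4_roots (C : numClosedFieldType) (A0 A1 A2 A3 A4 : C) :
  stable_simple A0 A1 A2 A3 A4 ->
  exists r : seq C, [/\ uniq r, size r = 4%N &
    forall z, z \in r -> root (quartic A0 A1 A2 A3 A4) z /\ 'Re z < 0].
Proof.
move=> [[A0p A1p A2p] [A3p A4p] hurw [d3 d1] ndbl].
set Q := quartic _ _ _ _ _.
have A4n := lt0r_neq0 A4p.
have sQ : size Q = 5%N by exact: size_quartic.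
have Qn : Q != 0 by rewrite -size_poly_gt0 sQ.
have [r Qr] := closed_field_poly_normal Q.
have lQ : lead_coef Q != 0 by rewrite lead_coef_eq0.
have rQ z : z \in r -> root Q z.
  by move=> zr; rewrite Qr rootZ // root_prod_XsubC.
exists r; split.
- (* The coefficients are real, so conjugation preserves multiplicities. *)
  have conjQ : map_poly Num.conj Q = Q.
    by rewrite /Q /quartic map_Poly /= !conj_Creal ?gtr0_real.
  have conjD x n : ('X - x%:P) ^+ n %| Q -> ('X - (x^*)%:P) ^+ n %| Q.
    have <- : map_poly Num.conj ('X - x%:P) = 'X - (x^*)%:P.
      by rewrite rmorphB /= map_polyX map_polyC.
    by rewrite -{2}conjQ -rmorphXn dvdp_map.
  apply: count_mem_uniq => z; case: (boolP (z \in r)) => [zr|]; last first.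
    by move/count_memPn.
  have muQ : mup z Q = count_mem z r.
    by rewrite -mu_prod_XsubC {1}Qr -mul_polyC mupMr // rootC.
  apply/eqP; rewrite eqn_leq -has_count has_pred1 zr andbT leqNgt -muQ.
  apply/negP => dbl.
  have znr : z != z^*.
    apply/eqP => /esym/CrealP zreal.
    have /eqP := rQ _ zr; rewrite horner_quartic => Qz.
    have := no_real_root_quartic A0p A2p A4p (gtr0_real A3p) (gtr0_real A1p)
      d3 d1 Qz.
    by rewrite zreal.
  suff /eqP : A4 * A1 ^+ 2 = A3 ^+ 2 * A0 by rewrite (lt_eqF ndbl).
  apply: (two_double_roots A4n znr dbl).
  by rewrite (mup_geq _ _ Qn); apply: conjD; rewrite -(mup_geq _ _ Qn).
- by have := sQ; rewrite Qr size_scale // size_prod_XsubC => -[].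
- move=> z /rQ Qz; split=> //; move: Qz; rewrite rootE horner_quartic => /eqP.
  exact: hurwitz4_root_Re_lt0.
Qed.

(** * The Cayley transform *)

Lemma cayley_disc (C : numClosedFieldType) (z : C) :
  'Re z < 0 -> `|(1 + z) / (1 - z)| < 1.
Proof.
move=> z0; have lt : `|1 + z| < `|1 - z|.
  rewrite -(@ltr_pXn2r _ 2) ?nnegrE //.
  rewrite !normCK rmorphB rmorphD /= rmorph1 -subr_gt0.
  have -> : (1 - z) * (1 - z^*) - (1 + z) * (1 + z^*) = - (4 * 'Re z).
    by rewrite ReE; field.
  by rewrite oppr_gt0 pmulr_rlt0.
by rewrite normf_div ltr_pdivrMr ?mul1r //; apply: le_lt_trans lt.
Qed.

Lemma cayley_inj (C : numClosedFieldType) (z w : C) :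
  1 - z != 0 -> 1 - w != 0 ->
  (1 + z) / (1 - z) = (1 + w) / (1 - w) -> z = w.
Proof.
move=> zn wn /eqP; rewrite eqr_div // => /eqP h.
have two : (2 : C) != 0 by rewrite pnatr_eq0.
apply: (mulfI two); apply/eqP; rewrite -subr_eq0; apply/eqP.
transitivity ((1 + z) * (1 - w) - (1 + w) * (1 - z)); first by ring.
by rewrite h subrr.
Qed.

Lemma horner_quartic_cayley (F : fieldType) (p0 p1 p2 p3 p4 z : F) :
  1 - z != 0 ->
  (quartic p0 p1 p2 p3 p4).[(1 + z) / (1 - z)] * (1 - z) ^+ 4 =
  (quartic (p0 + p1 + p2 + p3 + p4) (4 * p4 + 2 * p3 - 2 * p1 - 4 * p0)
     (6 * p4 - 2 * p2 + 6 * p0) (4 * p4 - 2 * p3 + 2 * p1 - 4 * p0)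
     (p4 - p3 + p2 - p1 + p0)).[z].
Proof. by move=> zn; rewrite !horner_quartic; field. Qed.

Lemma simple_roots (F : fieldType) (p : {poly F}) (s : seq F) :
  uniq s -> size p = (size s).+1 ->
  (forall z, z \in s -> root p z) -> forall z, z \in s -> mup z p = 1%N.
Proof.
move=> us sp rp z zs.
have pn : p != 0 by rewrite -size_poly_gt0 sp.
have pE : p = lead_coef p *: \prod_(w <- s) ('X - w%:P).
  by apply: all_roots_prod_XsubC; rewrite ?uniq_rootsE //; apply/allP.
rewrite pE -mul_polyC mupMr ?rootC ?lead_coef_eq0 //.
by rewrite mu_prod_XsubC count_uniq_mem // zs.
Qed.

(** Only evaluations are transported by the change of variable: as it is
    injective, distinct roots [z] give as many distinct roots of [p] as the
    degree of [p] allows, so these are automatically simple. *)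
Lemma cayley_roots (C : numClosedFieldType) (p Q : {poly C}) (k : C)
    (r : seq C) :
  k != 0 -> size p = (size r).+1 -> uniq r ->
  (forall z, 1 - z != 0 ->
     p.[(1 + z) / (1 - z)] * (1 - z) ^+ size r = k * Q.[z]) ->
  (forall z, z \in r -> root Q z /\ 'Re z < 0) ->
  exists s : seq C, [/\ uniq s, size s = size r &
    forall y, y \in s -> mup y p = 1%N /\ `|y| < 1].
Proof.
move=> kn sp ur pQ rP.
have n1 z : z \in r -> 1 - z != 0.
  move=> /rP[_ z0]; rewrite subr_eq0; apply/eqP => z1.
  by move: z0; rewrite -z1 (Creal_ReP _ _) ?real1 // ltr10.
pose s := [seq (1 + z) / (1 - z) | z <- r].
have us : uniq s.
  by rewrite map_inj_in_uniq // => z w /n1 zn /n1 wn; apply: cayley_inj.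
exists s; split; rewrite ?size_map // => y ys; split.
  apply: (simple_roots us) ys; rewrite ?size_map //.
  move=> _ /mapP[z zr ->]; have zn := n1 _ zr.
  have := pQ _ zn; have [/eqP-> _] := rP _ zr.
  by rewrite mulr0 => /eqP; rewrite mulf_eq0 expf_eq0 (negPf zn) andbF orbF.
by have /mapP[z /rP[_ z0] ->] := ys; apply: cayley_disc.
Qed.

(** The sums are the coefficients of the Cayley transform of the quartic
    ([horner_quartic_cayley]). The factor [k] is there because the conditions in
    [stable_simple] are homogeneous, so that the [Ai] may be normalised. *)
Lemma four_simple_roots_quartic (R : realType)
    (k p0 p1 p2 p3 p4 A0 A1 A2 A3 A4 : R) :
  stable_simple A0 A1 A2 A3 A4 -> 0 < k -> p4 != 0 ->
  p0 + p1 + p2 + p3 + p4 = k * A0 ->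
  4 * p4 + 2 * p3 - 2 * p1 - 4 * p0 = k * A1 ->
  6 * p4 - 2 * p2 + 6 * p0 = k * A2 ->
  4 * p4 - 2 * p3 + 2 * p1 - 4 * p0 = k * A3 ->
  p4 - p3 + p2 - p1 + p0 = k * A4 ->
  four_simple_roots_in_unit_disc
    (map_poly (real_complex R) (quartic p0 p1 p2 p3 p4)).
Proof.
move=> [[A0p A1p A2p] [A3p A4p] hurw [d3 d1] ndbl] k0 p4n e0 e1 e2 e3 e4.
pose c : {rmorphism R -> R[i]} := real_complex R.
have cgt0 x : 0 < x -> 0 < c x by rewrite /c -ltcR.
have clt x y : x < y -> c x < c y by rewrite /c ltcR.
have [r [ur sr rP]] : exists r : seq R[i], [/\ uniq r, size r = 4%N &
    forall z, z \in r -> root (quartic (c A0) (c A1) (c A2) (c A3) (c A4)) z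
      /\ 'Re z < 0].
  apply: hurwitz4_roots; split; rewrite ?cgt0 //.
  - by move: (clt _ _ hurw); rewrite !(rmorphD, rmorphM, rmorphXn).
  - split.
      by move: (clt _ _ d3); rewrite !(rmorphM, rmorphXn, rmorph_nat).
    by move: (clt _ _ d1); rewrite !(rmorphM, rmorphXn, rmorph_nat).
  - by move: (clt _ _ ndbl); rewrite !(rmorphM, rmorphXn).
have kn : c k != 0 by rewrite gt_eqF // cgt0.
have -> : map_poly (real_complex R) (quartic p0 p1 p2 p3 p4) =
    quartic (c p0) (c p1) (c p2) (c p3) (c p4) by exact: (map_Poly c).
rewrite /four_simple_roots_in_unit_disc -sr.
pose Q := quartic (c A0) (c A1) (c A2) (c A3) (c A4).
apply: (@cayley_roots _ _ Q (c k)) => //.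
  by rewrite size_quartic ?sr // fmorph_eq0.
move=> z zn; rewrite sr horner_quartic_cayley // !horner_quartic.
rewrite !mulrDr !mulrA -!(rmorphM c) -e0 -e1 -e2 -e3 -e4.
by ring.
Qed.

(** * Small time steps *)

Definition eventually_small (R : numDomainType) (P : R -> Prop) : Prop :=
  exists2 d : R, 0 < d & forall t : R, 0 < t -> t < d -> P t.

Lemma eventually_small_and (R : realDomainType) (P Q : R -> Prop) :
  eventually_small P -> eventually_small Q ->
  eventually_small (fun t => P t /\ Q t).
Proof.
move=> [d d0 dP] [e e0 eQ]; exists (Num.min d e); first by rewrite lt_min d0 e0.
by move=> t t0; rewrite lt_min => /andP[td te]; split; [apply: dP|apply: eQ].
Qed.

Lemma eventually_small_ord (R : realFieldType) (n : nat)
    (P : 'I_n -> R -> Prop) :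
  (forall i, eventually_small (P i)) ->
  eventually_small (fun t => forall i, P i t).
Proof.
elim: n P => [|n IH] P Ps; first by exists 1 => // t _ _ [].
have [d d0 dP] :=
  eventually_small_and (Ps ord0) (IH _ (fun i => Ps (lift ord0 i))).
exists d => // t t0 td i; have [P0 PS] := dP t t0 td.
by case: (unliftP ord0 i) => [j|] ->.
Qed.

Lemma eventually_small_poly_gt0 (R : rcfType) (p : {poly R}) :
  0 < p.[0] -> eventually_small (fun t => 0 < p.[t]).
Proof.
move=> p0; have [d d0 dP] := poly_cont 0 p p0.
exists d => // t t0 td; have := dP t; rewrite subr0 gtr0_norm // => /(_ td).
by rewrite ltr_norml => /andP[+ _]; rewrite ltrBrDl addrN.
Qed.

(** With [u = 4 a - e t^2], [w = 4 c + e t^2] and [v = A4], one has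
    [A3 = 2 t u] and [A2 = t (u + w)], and every condition reduces, after
    removal of a monomial factor in [t], to the positivity of a polynomial
    whose value at [0] is positive. In particular the Routh-Hurwitz inequality
    becomes [0 < u w - e t v], of value [16 a c] at [0], and the last
    condition becomes [0 < u^2 - e t v]. *)
Lemma stable_simple_small (R : rcfType) (a c e : R) : 0 < a -> 0 < c -> 0 < e ->
  eventually_small (fun t =>
    stable_simple (e * t ^+ 3) (2 * e * t ^+ 3) (4 * (a + c) * t)
      (8 * a * t - 2 * e * t ^+ 3) (16 + 4 * (a - c) * t - e * t ^+ 3)).
Proof.
move=> a0 c0 e0.
have hE := (hornerD, hornerN, hornerM, hornerC, hornerX, @horner_exp R).
have [u uE] : exists u : {poly R}, forall t, u.[t] = 4 * a - e * t ^+ 2.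
  by exists ((4 * a)%:P - e%:P * 'X ^+ 2) => t; rewrite !hE.
have [v vE] : exists v : {poly R},
    forall t, v.[t] = 16 + 4 * (a - c) * t - e * t ^+ 3.
  exists (16%:P + (4 * (a - c))%:P * 'X - e%:P * 'X ^+ 3) => t.
  by rewrite !hE.
have [w wE] : exists w : {poly R}, forall t, w.[t] = 4 * c + e * t ^+ 2.
  by exists ((4 * c)%:P + e%:P * 'X ^+ 2) => t; rewrite !hE.
have u0 : u.[0] = 4 * a by rewrite uE expr0n mulr0 subr0.
have v0 : v.[0] = 16 by rewrite vE expr0n /=; ring.
have w0 : w.[0] = 4 * c by rewrite wE expr0n mulr0 addr0.
have hu : 0 < u.[0] by rewrite u0; lra.
have hv : 0 < v.[0] by rewrite v0; lra.
have hw : 0 < (u * w - e%:P * 'X * v).[0].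
  by rewrite !hE v0 u0 w0; nra.
have hx : 0 < (u ^+ 2 - e%:P * 'X * v).[0].
  by rewrite !hE v0 u0; nra.
have hy : 0 < ((2 * (a + c))%:P * v - 'X * u ^+ 2).[0].
  by rewrite !hE v0 u0; nra.
have hz : 0 < ((2 * (a + c))%:P - e%:P * 'X ^+ 2).[0].
  by rewrite !hE; nra.
have S := eventually_small_poly_gt0.
have [d d0 dP] := eventually_small_and (S _ _ hu)
  (eventually_small_and (S _ _ hv)
  (eventually_small_and (S _ _ hw) (eventually_small_and (S _ _ hx)
  (eventually_small_and (S _ _ hy) (S _ _ hz))))).
exists d => // t t0 td; have := dP t t0 td.
rewrite !hE => -[] {}hu [] {}hv [] {}hw [] {}hx [] {}hy {}hz.
have A3E : 8 * a * t - 2 * e * t ^+ 3 = 2 * t * u.[t] by rewrite uE; ring.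
have acE : 4 * (a + c) = u.[t] + w.[t] by rewrite uE wE; ring.
have f1 : 0 < 4 * e * t ^+ 5 by rewrite !mulr_gt0 ?exprn_gt0.
have f2 : 0 < 4 * t by rewrite mulr_gt0.
have f3 : 0 < 4 * e * t ^+ 4 by rewrite !mulr_gt0 ?exprn_gt0.
rewrite A3E -vE; split.
- by rewrite !mulr_gt0 ?exprn_gt0 ?addr_gt0.
- by rewrite !mulr_gt0.
- rewrite -subr_gt0; have := mulr_gt0 f1 hw; congr (_ < _).
  by rewrite acE; ring.
- split.
    by rewrite -subr_gt0; have := mulr_gt0 f2 hy; congr (_ < _); ring.
  by rewrite -subr_gt0; have := mulr_gt0 f3 hz; congr (_ < _); ring.
- by rewrite -subr_gt0; have := mulr_gt0 f1 hx; congr (_ < _); ring.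
Qed.

Theorem theorem2 (R : realType) (rho_s rho_f alpha H_s : R)
    (hrho_s : 0 < rho_s) (hrho_f : 0 < rho_f)
    (halpha : 0 < alpha) (hH_s : 0 < H_s)
    (N : nat) (mu lambda : 'I_N -> R)
    (hmu : forall i, 0 < mu i) (hlambda : forall i, 0 < lambda i)
    (beta psi : R) (hbp : forall i, 0 < beta + psi * lambda i) :
  exists2 delta : R, 0 < delta &
    forall dt : R, 0 < dt -> dt < delta ->
      forall i : 'I_N,
        four_simple_roots_in_unit_disc
          (chiC rho_s rho_f alpha H_s beta psi dt (mu i) (lambda i)).
Proof.
apply: eventually_small_ord => i.
have m0 := hmu i; have b0 := hbp i.
pose a := alpha / (rho_f * mu i); pose c := alpha / (rho_s * H_s).
pose e := a * (beta + psi * lambda i) / (rho_s * H_s).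
have a0 : 0 < a by rewrite divr_gt0 // mulr_gt0.
have c0 : 0 < c by rewrite divr_gt0 // mulr_gt0.
have e0 : 0 < e by apply: divr_gt0; apply: mulr_gt0.
have [d dp dP] := stable_simple_small a0 c0 e0.
exists d => // t t0 td.
have sn := lt0r_neq0 hrho_s; have hn := lt0r_neq0 hH_s.
have fn := lt0r_neq0 hrho_f; have mn := lt0r_neq0 m0; have tn := lt0r_neq0 t0.
have -> : chiC rho_s rho_f alpha H_s beta psi t (mu i) (lambda i) =
  map_poly (real_complex R) (quartic
    (rho_s * H_s / t ^+ 2)
    (alpha / t - 4 * rho_s * H_s / t ^+ 2)
    (alpha * rho_s * H_s / (rho_f * mu i * t) - 2 * alpha / t
      + 6 * rho_s * H_s / t ^+ 2)
    (- (2 * alpha * rho_s * H_s / (rho_f * mu i * t))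
      + alpha * t / (rho_f * mu i) * (beta + psi * lambda i)
      + alpha / t - 4 * rho_s * H_s / t ^+ 2)
    (rho_s * H_s / t ^+ 2 * (1 + alpha * t / (rho_f * mu i)))).
  rewrite /chiC; congr map_poly; rewrite /chi /quartic /= !cons_poly_def.
  by rewrite -!mul_polyC; ring.
have k0 : 0 < rho_s * H_s / t ^+ 2 by rewrite divr_gt0 ?mulr_gt0 ?exprn_gt0.
apply: (four_simple_roots_quartic (dP t t0 td) k0).
- by rewrite mulf_neq0 ?lt0r_neq0 // addr_gt0 // divr_gt0 ?mulr_gt0.
- by rewrite /e /a; field; rewrite sn hn fn mn tn.
- by rewrite /e /a; field; rewrite sn hn fn mn tn.
- by rewrite /e /a /c; field; rewrite sn hn fn mn tn.
- by rewrite /e /a; field; rewrite sn hn fn mn tn.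
- by rewrite /e /a /c; field; rewrite sn hn fn mn tn.
Qed.
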